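(* Let $P$ be a finite poset. Then the homomorphism \[ \operatorname{Rk}\colon \mathrm{K}_0(\mathcal{E}_{\operatorname{Rk}})\to\mathbb{Z}^{\{\le_P\}} \] induced by the rank invariant is an isomorphism. Moreover, each of the following three sets is a basis of $\mathrm{K}_0(\mathcal{E}_{\operatorname{Rk}})$: \[ \{[\mathbf{k}_{\langle i,j\rangle}]\mid i\le j\in P\},\qquad \{[\mathbf{k}_{\langle i,j\langle}]\mid i<j\in P\cup\{\infty\}\},\qquad \{[\mathbf{k}_{\rangle i,j\rangle}]\mid i<j\in P\cup\{-\infty\}\}. \]
   Context: Fix a field $\mathbf{k}$. $\operatorname{rep}P$ is the category of functors from the poset $P$ to finite-dimensional $\mathbf{k}$-vector spaces. $\{\le_P\}=\{(s,t)\in P\times P\mid s\le t\}$. For $M\in\operatorname{rep}P$, the rank invariant $\operatorname{Rk}M\in\mathbb{Z}^{\{\le_P\}}$ is $\operatorname{Rk}M(s,t)=\operatorname{rank}[M(s)\to M(t)]$. For a convex subset $I\subseteq P$, $\mathbf{k}_I$ is the representation equal to $\mathbf{k}$ on $I$, $0$ elsewhere, with identity maps between comparable elements of $I$. With the convention $-\infty<p<\infty$ for all $p\in P$, define: segments $\langle i,j\rangle=\{\ell\in P\mid i\le\ell\le j\}$ for $i\le j\in P$; lower hooks $\langle i,j\langle=\{\ell\in P\mid i\le\ell\not\ge j\}$ for $i\in P$, $j\in P\cup\{\infty\}$, $i<j$; upper hooks $\rangle i,j\rangle=\{\ell\in P\mid i\not\ge\ell\le j\}$ for $i\in P\cup\{-\infty\}$,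 $j\in P$, $i<j$. A short exact sequence $0\to A\to B\to C\to0$ in $\operatorname{rep}P$ is rank-exact if $\operatorname{Rk}B=\operatorname{Rk}A+\operatorname{Rk}C$; $\mathcal{E}_{\operatorname{Rk}}$ denotes $\operatorname{rep}P$ together with the class of rank-exact sequences. $\mathrm{K}_0(\mathcal{E}_{\operatorname{Rk}})$ is the abelian group generated by (isomorphism classes of) objects $[A]$ of $\operatorname{rep}P$ modulo the relations $[B]=[A]+[C]$ for every rank-exact sequence $0\to A\to B\to C\to0$. The map $[M]\mapsto\operatorname{Rk}M$ is then a well-defined homomorphism on $\mathrm{K}_0(\mathcal{E}_{\operatorname{Rk}})$. *)

(* Defs.v *)
From HB Require Import structures.
From mathcomp Require Import all_boot all_order all_algebra.
From mathcomp Require Import generic_quotient ring_quotient.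
From mathcomp Require Import boolp classical_sets.
From mathcomp.multinomials Require Import freeg.

Set Implicit Arguments.
Unset Strict Implicit.
Unset Printing Implicit Defensive.

Import Order.TTheory GRing.Theory.
Local Open Scope ring_scope.

Section Representations.
Variables (k : fieldType) (d : Order.disp_t) (P : finPOrderType d).

(* Functors from P, seen as a category with one arrow s -> t for each s <= t,
   to finite-dimensional k-vector spaces. *)
Record rep := Rep {
  rspace : P -> vectType k;
  rmap : forall s t : P, (s <= t)%O -> 'Hom(rspace s, rspace t);
  rmap_id : forall s : P, rmap (lexx s) = \1%VF;
  rmap_comp : forall (s t u : P) (st : (s <= t)%O) (tu : (t <= u)%O),
    rmap (le_trans st tu) = (rmap tu \o rmap st)%VF
}.

(* Natural transformations. *)
Record rep_hom (A B : rep) := RepHom {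
  hom_at : forall s : P, 'Hom(rspace A s, rspace B s);
  hom_nat : forall (s t : P) (st : (s <= t)%O),
    (hom_at t \o rmap A st)%VF = (rmap B st \o hom_at s)%VF
}.

Definition rep_iso (A B : rep) : Prop :=
  exists (f : rep_hom A B) (g : rep_hom B A), forall s : P,
    (hom_at g s \o hom_at f s = \1)%VF /\ (hom_at f s \o hom_at g s = \1)%VF.

(* Exactness in a functor category is pointwise. *)
Definition short_exact (A B C : rep) (f : rep_hom A B) (g : rep_hom B C) :=
  forall s : P, [/\ lker (hom_at f s) = 0%VS,
                    limg (hom_at f s) = lker (hom_at g s) &
                    limg (hom_at g s) = fullv].

(* The set {<=_P} of pairs (s, t) with s <= t. *)
Definition ordered_pair := {st : P * P | (st.1 <= st.2)%O}.

Definition Rk (M : rep) : {ffun ordered_pair -> int} :=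
  [ffun st : ordered_pair => (\dim (limg (rmap M (valP st))))%:Z].

Definition rank_exact (A B C : rep) (f : rep_hom A B) (g : rep_hom B C) :=
  short_exact f g /\ Rk B = Rk A + Rk C.

Lemma rep_iso_refl A : rep_iso A A.
Proof.
have nat_id s t (st : (s <= t)%O) :
    (\1 \o rmap A st)%VF = (rmap A st \o \1)%VF.
  by rewrite comp_lfun1l comp_lfun1r.
by exists (RepHom nat_id), (RepHom nat_id) => s /=; rewrite comp_lfun1l.
Qed.

Lemma rep_iso_sym A B : rep_iso A B -> rep_iso B A.
Proof. by case=> f [g fg]; exists g, f => s; case: (fg s). Qed.

Lemma rep_iso_trans B A C : rep_iso A B -> rep_iso B C -> rep_iso A C.
Proof.
have comp_nat (X Y Z : rep) (f : rep_hom X Y) (g : rep_hom Y Z) s t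
    (st : (s <= t)%O) : ((hom_at g t \o hom_at f t) \o rmap X st)%VF
     = (rmap Z st \o (hom_at g s \o hom_at f s))%VF.
  by rewrite -comp_lfunA hom_nat comp_lfunA hom_nat comp_lfunA.
case=> f [f' ff] [g [g' gg]].
exists (RepHom (comp_nat _ _ _ f g)), (RepHom (comp_nat _ _ _ g' f')) => s /=.
case: (ff s) (gg s) => [f1 f2] [g1 g2]; split.
  by rewrite comp_lfunA -(comp_lfunA _ _ (hom_at g s)) g1 comp_lfun1r f1.
by rewrite comp_lfunA -(comp_lfunA _ _ (hom_at f' s)) f2 comp_lfun1r g2.
Qed.

Lemma Rk_iso A B : rep_iso A B -> Rk A = Rk B.
Proof.
case=> f [g fg]; apply/ffunP=> st; rewrite !ffunE.
move: (valP st); move: (val st).1 (val st).2 => s t {}st.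
case: (fg s) (fg t) => gfs fgs [gft _]; congr (Posz _).
have -> : rmap B st = (hom_at f t \o rmap A st \o hom_at g s)%VF.
  by rewrite hom_nat -comp_lfunA fgs comp_lfun1r.
have ft0 : lker (hom_at f t) == 0%VS.
  apply/lker0P=> x y /(congr1 (hom_at g t)).
  by rewrite -!comp_lfunE gft !id_lfunE.
have gs1 : limg (hom_at g s) = fullv.
  apply/eqP; rewrite eqEsubv subvf /=; apply/subvP=> x _.
  by rewrite -[x]id_lfunE -gfs comp_lfunE memv_img ?memvf.
by rewrite !limg_comp gs1 [RHS]limg_dim_eq // (eqP ft0) capv0.
Qed.

(* [rep] lives in a universe too large to carry a choiceType structure, but its
   isomorphism classes form a small type: every object is isomorphic to one made
   of coordinate spaces and matrices.  Such matrix representations serve only to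
   build [isoclass], the type of isomorphism classes of all objects (isoclassP,
   isoclass_surj).  Matrices act on row vectors, hence the order of factors in
   mxrep_comp. *)
Record mxrep := MxRep {
  mxrep_dim : P -> nat;
  mxrep_mx : forall s t : P, (s <= t)%O -> 'M[k]_(mxrep_dim s, mxrep_dim t);
  mxrep_id : forall s : P, mxrep_mx (lexx s) = 1%:M;
  mxrep_comp : forall (s t u : P) (st : (s <= t)%O) (tu : (t <= u)%O),
    mxrep_mx (le_trans st tu) = mxrep_mx st *m mxrep_mx tu
}.

HB.instance Definition _ := gen_eqMixin mxrep.
HB.instance Definition _ := gen_choiceMixin mxrep.

Fact rep_of_id (a : mxrep) s : linfun (mulmxr (mxrep_mx a (lexx s))) =
  \1%VF :> 'Hom('rV_(mxrep_dim a s), 'rV_(mxrep_dim a s)).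
Proof. by apply/lfunP=> v; rewrite !lfunE /= mxrep_id mulmx1. Qed.

Fact rep_of_comp (a : mxrep) s t u (st : (s <= t)%O) (tu : (t <= u)%O) :
  linfun (mulmxr (mxrep_mx a (le_trans st tu))) =
  (linfun (mulmxr (mxrep_mx a tu)) \o linfun (mulmxr (mxrep_mx a st)))%VF
  :> 'Hom('rV_(mxrep_dim a s), 'rV_(mxrep_dim a u)).
Proof. by apply/lfunP=> v; rewrite !lfunE /= !lfunE /= mxrep_comp mulmxA. Qed.

Definition rep_of (a : mxrep) : rep :=
  @Rep (fun s => 'rV[k]_(mxrep_dim a s))
       (fun s t st => linfun (mulmxr (mxrep_mx a st)))
       (rep_of_id a) (rep_of_comp a).

Section Coordinates.
Import passmx.

Let e (M : rep) (s : P) := vbasis {: rspace M s}.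
Let eP (M : rep) (s : P) : basis_of {: rspace M s} (e M s).
Proof. exact: vbasisP. Qed.

Fact coord_mx_id (M : rep) s : mxof (e M s) (e M s) (rmap M (lexx s)) = 1%:M.
Proof. by rewrite rmap_id mxof1 // (basis_free (eP M s)). Qed.

Fact coord_mx_comp (M : rep) s t u (st : (s <= t)%O) (tu : (t <= u)%O) :
  mxof (e M s) (e M u) (rmap M (le_trans st tu)) =
  mxof (e M s) (e M t) (rmap M st) *m mxof (e M t) (e M u) (rmap M tu).
Proof. by rewrite rmap_comp; apply: mxof_comp; apply: eP. Qed.

Definition mxrep_of (M : rep) : mxrep :=
  @MxRep (fun s => \dim {: rspace M s})
         (fun s t st => mxof (e M s) (e M t) (rmap M st))
         (coord_mx_id M) (coord_mx_comp M).

Lemma mxrep_ofK (M : rep) : rep_iso (rep_of (mxrep_of M)) M.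
Proof.
have vecof_nat s t (st : (s <= t)%O) :
    (linfun (vecof (e M t)) \o rmap (rep_of (mxrep_of M)) st)%VF
    = (rmap M st \o linfun (vecof (e M s)))%VF.
  apply/lfunP=> v; rewrite !comp_lfunE !lfunE /=.
  by rewrite (hom_vecof _ (eP M t)).
have rVof_nat s t (st : (s <= t)%O) :
    (linfun (rVof (e M t)) \o rmap M st)%VF
    = (rmap (rep_of (mxrep_of M)) st \o linfun (rVof (e M s)))%VF.
  apply/lfunP=> v; rewrite !comp_lfunE !lfunE /=.
  by rewrite (rVof_app _ (eP M s)).
exists (@RepHom (rep_of (mxrep_of M)) M
          (fun s => linfun (vecof (e M s))) vecof_nat),
       (@RepHom M (rep_of (mxrep_of M))
          (fun s => linfun (rVof (e M s))) rVof_nat) => s.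
have eMs := eP M s.
by split; apply/lfunP=> v; rewrite comp_lfunE !lfunE /= ?vecofK ?rVofK.
Qed.

End Coordinates.

Definition mxrep_iso (a b : mxrep) : bool :=
  `[< rep_iso (rep_of a) (rep_of b) >].

Fact mxrep_iso_equiv : equiv_class_of mxrep_iso.
Proof.
split=> [a|a b|b a c]; first exact/asboolP/rep_iso_refl.
  by apply: asbool_equiv_eq; split; apply: rep_iso_sym.
by move=> /asboolP ab /asboolP bc; apply/asboolP/(rep_iso_trans ab).
Qed.
Canonical mxrep_iso_equivRel := EquivRelPack mxrep_iso_equiv.
Canonical mxrep_iso_encModRel := defaultEncModRel mxrep_iso.

Definition isoclass := {eq_quot mxrep_iso}%qT.
HB.instance Definition _ := Choice.on isoclass.

Definition isoclass_of (M : rep) : isoclass := (\pi_isoclass (mxrep_of M))%qT.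

Lemma isoclassP (A B : rep) : isoclass_of A = isoclass_of B <-> rep_iso A B.
Proof.
split=> [/eqmodP/asboolP AB|AB]; last apply/eqmodP/asboolP.
  apply: rep_iso_trans (mxrep_ofK B); apply: rep_iso_trans AB.
  exact/rep_iso_sym/mxrep_ofK.
apply: (rep_iso_trans (mxrep_ofK A)); apply: (rep_iso_trans AB).
exact/rep_iso_sym/mxrep_ofK.
Qed.

Definition isoclass_rep (c : isoclass) : rep := rep_of (repr c).

Lemma isoclass_repK : cancel isoclass_rep isoclass_of.
Proof.
move=> c; rewrite -[RHS](@reprK _ isoclass); apply/eqmodP/asboolP.
exact: mxrep_ofK.
Qed.

Lemma isoclass_surj (c : isoclass) : exists M, isoclass_of M = c.
Proof. by exists (isoclass_rep c); apply: isoclass_repK. Qed.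

(* The subgroup generated by the relations [B] = [A] + [C]. *)
Inductive K0_relation : {freeg isoclass / int} -> Prop :=
| K0_rank_exact (A B C : rep) (f : rep_hom A B) (g : rep_hom B C) :
    rank_exact f g ->
    K0_relation (<< isoclass_of B >>
                 - (<< isoclass_of A >> + << isoclass_of C >>))
| K0_relation0 : K0_relation 0
| K0_relationB x y : K0_relation x -> K0_relation y -> K0_relation (x - y).

Definition K0_relations : pred {freeg isoclass / int} :=
  fun x => `[< K0_relation x >].

Fact K0_relations_zmod_closed : zmod_closed K0_relations.
Proof.
split=> [|x y]; first by apply/asboolP; constructor.
by move=> /asboolP xR /asboolP yR; apply/asboolP; constructor.
Qed.
HB.instance Definition _ :=
  GRing.isZmodClosed.Build {freeg isoclass / int} K0_relations
    K0_relations_zmod_closed.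

Definition K0 :=
  Quotient.quot (GRing.ZmodClosed.clone {freeg isoclass / int} K0_relations _).
HB.instance Definition _ := GRing.Zmodule.on K0.
HB.instance Definition _ := Quotient.on K0.

Definition K0_class (M : rep) : K0 :=
  (\pi_K0 << isoclass_of M >>)%qT.

Lemma K0_class_rank_exact (A B C : rep) (f : rep_hom A B) (g : rep_hom B C) :
  rank_exact f g -> K0_class B = K0_class A + K0_class C.
Proof.
move=> fg; rewrite /K0_class -raddfD; apply/eqP.
by rewrite -Quotient.idealrBE; apply/asboolP; apply: K0_rank_exact fg.
Qed.

Definition Rk_freeg : {freeg isoclass / int} -> {ffun ordered_pair -> int} :=
  fglift (Rk \o isoclass_rep : isoclass -> zmodule {ffun ordered_pair -> int}).

Definition RkK0 (x : K0) : {ffun ordered_pair -> int} :=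
  Rk_freeg (repr x).

Fact Rk_freeg_additive : zmod_morphism Rk_freeg.
Proof. by move=> x y; rewrite /Rk_freeg (lift_is_additive _ x y). Qed.
HB.instance Definition _ := GRing.isZmodMorphism.Build _ _ _ Rk_freeg_additive.

Lemma Rk_freegU M : Rk_freeg << isoclass_of M >> = Rk M.
Proof.
rewrite /Rk_freeg liftU scale1r /=; apply/Rk_iso/isoclassP.
exact: isoclass_repK.
Qed.

Lemma RkK0_pi x : RkK0 (\pi_K0 x)%qT = Rk_freeg x.
Proof.
have Rk0 y : K0_relation y -> Rk_freeg y = 0.
  elim=> {y}[A B C f g [_ RkB]||y z _ y0 _ z0].
  - by rewrite raddfB raddfD /= !Rk_freegU RkB subrr.
  - exact: raddf0.
  - by rewrite raddfB /= y0 z0 subrr.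
apply/eqP; rewrite /RkK0 -subr_eq0 -raddfB /= Rk0 //.
apply/asboolP; rewrite -[`[<_>]]/(_ \in K0_relations) Quotient.idealrBE.
by rewrite reprK.
Qed.

Fact RkK0_additive : zmod_morphism RkK0.
Proof.
move=> x y; rewrite -[x](@reprK _ K0).
rewrite -[y](@reprK _ K0) -raddfB !RkK0_pi.
exact: raddfB.
Qed.
HB.instance Definition _ := GRing.isZmodMorphism.Build _ _ _ RkK0_additive.

Lemma RkK0E M : RkK0 (K0_class M) = Rk M.
Proof. by rewrite RkK0_pi Rk_freegU. Qed.

Definition convex (I : {set P}) : Prop :=
  forall s t u : P, s \in I -> u \in I -> (s <= t)%O -> (t <= u)%O -> t \in I.

Section IntervalRep.
Variables (I : {set P}) (cI : convex I).

(* The space at s is k^(s \in I), the boolean being read as 0 or 1; the 1 x 1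
   matrix const_mx 1 is the identity of k. *)
Definition interval_map (s t : P) (_ : (s <= t)%O) :
    'Hom('rV[k]_(s \in I), 'rV[k]_(t \in I)) := linfun (mulmxr (const_mx 1)).

Fact interval_map_id (s : P) : interval_map (lexx s) = \1%VF.
Proof.
apply/lfunP=> v; rewrite !lfunE /=; move: v; case: (s \in I) => v.
  by rewrite [const_mx 1](_ : _ = 1%:M) ?mulmx1 //; apply/matrixP=> i j;
    rewrite !ord1 !mxE.
by rewrite [LHS]thinmx0 [RHS]thinmx0.
Qed.

Fact interval_map_comp (s t u : P) (st : (s <= t)%O) (tu : (t <= u)%O) :
  interval_map (le_trans st tu) = (interval_map tu \o interval_map st)%VF.
Proof.
apply/lfunP=> v; rewrite comp_lfunE !lfunE /= -mulmxA.
case: (boolP (t \in I)) => tI.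
  congr (_ *m _); apply/matrixP=> i j; rewrite !mxE.
  by rewrite big_ord1 !mxE mulr1.
apply/rowP=> j; rewrite !mxE; apply: eq_bigr => i _; exfalso.
have sI : s \in I by case: (s \in I) i => // -[].
have uI : u \in I by case: (u \in I) j => // -[].
by rewrite (cI sI uI st tu) in tI.
Qed.

Definition interval_rep : rep :=
  @Rep (fun s => 'rV[k]_(s \in I)) interval_map
       interval_map_id interval_map_comp.

End IntervalRep.

Definition segment (i j : P) : {set P} := [set l | (i <= l <= j)%O].

(* None stands for +oo; no l in P satisfies l >= +oo. *)
Definition lower_hook (i : P) (j : option P) : {set P} :=
  [set l | (i <= l)%O && (if j is Some j' then ~~ (j' <= l)%O else true)].

(* None stands for -oo; no l in P satisfies -oo >= l. *)
Definition upper_hook (i : option P) (j : P) : {set P} :=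
  [set l | (if i is Some i' then ~~ (l <= i')%O else true) && (l <= j)%O].

Definition lt_oo (i : P) (j : option P) : bool :=
  if j is Some j' then (i < j')%O else true.
Definition oo_lt (i : option P) (j : P) : bool :=
  if i is Some i' then (i' < j)%O else true.

Fact segment_convex i j : convex (segment i j).
Proof.
move=> s t u; rewrite !inE => /andP[is_ _] /andP[_ uj] st tu.
by rewrite (le_trans is_ st) (le_trans tu uj).
Qed.

Fact lower_hook_convex i j : convex (lower_hook i j).
Proof.
move=> s t u; rewrite !inE => /andP[is_ _] /andP[_ uj] st tu.
rewrite (le_trans is_ st) /=; case: j uj => // j; apply: contra => jt.
exact: le_trans tu.
Qed.

Fact upper_hook_convex i j : convex (upper_hook i j).
Proof.
move=> s t u; rewrite !inE => /andP[si _] /andP[_ uj] st tu.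
rewrite (le_trans tu uj) andbT; case: i si => // i; apply: contra => ti.
exact: le_trans ti.
Qed.

Definition segment_rep i j := interval_rep (@segment_convex i j).
Definition lower_hook_rep i j := interval_rep (@lower_hook_convex i j).
Definition upper_hook_rep i j := interval_rep (@upper_hook_convex i j).

End Representations.

Arguments ordered_pair {d} P.
Arguments K0 k {d} P.
Arguments K0_class {k d P} M.
Arguments RkK0 {k d P} x.
Arguments segment_rep k {d P} i j.
Arguments lower_hook_rep k {d P} i j.
Arguments upper_hook_rep k {d P} i j.

Section ZBasis.
Local Open Scope classical_set_scope.

Definition Zbasis (V : zmodType) (B : set V) : Prop :=
  (forall x : V, exists (s : seq V) (c : V -> int),
     [set` s] `<=` B /\ x = \sum_(v <- s) v *~ c v) /\
  (forall (s : seq V) (c : V -> int), uniq s -> [set` s] `<=` B ->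
     \sum_(v <- s) v *~ c v = 0 -> forall v, v \in s -> c v = 0).

End ZBasis.

(* Main.v *)
(** The morphisms from the lower hook [L = <a,b<] to [M] form the space
    [ker (M a -> M b)], whose dimension is read off [Rk M], and a short exact
    sequence is rank-exact as soon as these kernels lift along it.  Hence the
    sum [Q] of all lower hooks [L], each taken [dim Hom(L, M)] times, maps onto
    [M] with a rank-exact kernel [N], and [N] = [Q] - [M] in K0.  Since
    [Hom(L, L')] is [k] for [L = L'] and otherwise vanishes unless [L'] comes
    strictly before [L], [Hom(L, N)] vanishes for one more layer of hooks than
    [Hom(L, M)]; iterating, the lower hooks generate K0.  The same triangularity
    makes their ranks independent, so [Rk] is injective on K0.  The ranks of the
    segments are unitriangular and generate the target, so [Rk] is onto; the
    upper hooks are handled by the dual functionals [dim coker (M a -> M b)]. *)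

From mathcomp Require Import boolp classical_sets.
Require Import Defs.
From HB Require Import structures.
From mathcomp Require Import all_boot all_order all_algebra.
From mathcomp Require Import generic_quotient.
From mathcomp.multinomials Require Import freeg.

Set Implicit Arguments.
Unset Strict Implicit.
Unset Printing Implicit Defensive.

Import Order.TTheory GRing.Theory.
Local Open Scope ring_scope.

(** * Unitriangular families in an abelian group *)

Lemma ffunMzE (T : finType) (V : zmodType) (f : {ffun T -> V}) (n : int) z :
  (f *~ n) z = f z *~ n.
Proof. by case: n => n; rewrite ?NegzE ?mulrNz ?ffunE -!pmulrn ffunMnE. Qed.

Section Triangular.
Variables (V : zmodType) (T : finType) (b : T -> V).
Variables (phi : {additive V -> {ffun T -> int}}) (rho : T -> nat).

(** Sorting [T] by [rho] makes the matrix of entries [phi (b y) x] lower unitriangular; the grading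
    [rho] stands in for a linear order on [T], so indices of equal height may coexist. *)
Definition unitriangular :=
  (forall y, phi (b y) y = 1) /\
  (forall x y, phi (b y) x != 0 -> y != x -> (rho y < rho x)%N).

Hypothesis phi_b : unitriangular.

Definition Zspan (x : V) := exists c : T -> int, x = \sum_y b y *~ c y.

Lemma phi_comb (c : T -> int) z :
  phi (\sum_y b y *~ c y) z = \sum_y phi (b y) z * c y.
Proof.
rewrite raddf_sum sum_ffunE; apply: eq_bigr => y _.
by rewrite raddfMz ffunMzE mulrzz.
Qed.

(** At height [n] only the diagonal term survives: any other contribution comes from a strictly
    lower index, where [phi x] vanishes. The sign is [sum - x] because in K0 this difference is the
    class of a kernel. *)
Lemma triangular_step n x : (forall y, (rho y < n)%N -> phi x y = 0) ->
  forall y, (rho y < n.+1)%N -> phi (\sum_y b y *~ phi x y - x) y = 0.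
Proof.
case: phi_b => b1 bT x0 z zn; rewrite raddfB /= !ffunE phi_comb.
rewrite (bigD1 z) //= b1 mul1r big1 ?addr0 ?subrr // => y yz.
case: (eqVneq (phi (b y) z) 0) => [->|/bT/(_ yz) yltz]; first by rewrite mul0r.
by rewrite x0 ?mulr0 // (leq_trans yltz).
Qed.

Lemma triangular_free (c : T -> int) :
  phi (\sum_y b y *~ c y) = 0 -> forall y, c y = 0.
Proof.
case: phi_b => b1 bT c0.
suff H n : forall y, (rho y < n)%N -> c y = 0.
  by move=> y; apply: (H (rho y).+1).
elim: n => // n IHn y yn.
have := phi_comb c y; rewrite c0 ffunE (bigD1 y) //= b1 mul1r big1.
  by rewrite addr0.
move=> z zy; case: (eqVneq (phi (b z) y) 0) => [->|/bT/(_ zy) zlty].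
  by rewrite mul0r.
by rewrite IHn ?mulr0 // (leq_trans zlty).
Qed.

(** A coincidence [b x = b y] puts the diagonal 1 at both indices, so each height would lie strictly
    below the other. *)
Lemma triangular_inj : injective b.
Proof.
case: phi_b => b1 bT x y bxy; apply/eqP; apply: contraT => xy.
have := bT y x; rewrite bxy b1 => /(_ isT xy) lt_xy.
have := bT x y; rewrite -bxy b1 (eq_sym y x) => /(_ isT xy) lt_yx.
by move: (ltn_trans lt_xy lt_yx); rewrite ltnn.
Qed.

(* For the lower hooks in K0, S consists of the classes of objects: for other x it is
   not known in advance that phi x = 0 forces x = 0. *)
Lemma triangular_span (S : V -> Prop) :
  (forall x, S x -> S (\sum_y b y *~ phi x y - x)) ->
  (forall x, S x -> phi x = 0 -> x = 0) ->
  forall x, S x -> Zspan x.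
Proof.
move=> Sstep S0.
pose B := (\max_y rho y).+1.
have rhoB y : (rho y < B)%N by rewrite ltnS; apply: (leq_bigmax y).
(* Here [phi x] vanishes below height [n], and [m] bounds the number of heights still to be
   cleared. *)
suff H m n : (B <= n + m)%N -> forall x, S x ->
    (forall y, (rho y < n)%N -> phi x y = 0) -> Zspan x.
  by move=> x Sx; apply: (H B 0%N).
elim: m n => [|m IHm] n Bn x Sx x0.
  exists (fun=> 0); rewrite big1 => [|y _]; last exact: mulr0z.
  apply: S0 => //; apply/ffunP=> y; rewrite ffunE x0 //.
  by rewrite addn0 in Bn; apply: leq_trans Bn.
have [|c xc] := IHm n.+1 _ _ (Sstep x Sx) (triangular_step x0).
  by rewrite addSnnS.
(* The remainder was [sum - x], so [x] is the sum minus the expansion of the remainder. *)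
exists (fun y => phi x y - c y).
under eq_bigr do rewrite mulrzBr.
by rewrite sumrB -xc subKr.
Qed.

Lemma triangular_Zbasis :
  (forall x, Zspan x) -> Zbasis [set x | exists y, x = b y]%classic.
Proof.
move=> bspan; split=> [x|s c s_uniq sb sc0].
  have [c ->] := bspan x.
  exists [seq b y | y <- index_enum T].
  exists (fun v => if [pick y | b y == v] is Some y then c y else 0); split.
    by move=> v /= /mapP[y _ ->]; exists y.
  rewrite big_map; apply: eq_bigr => y _.
  case: pickP => [z /eqP/triangular_inj-> //|].
  by move/(_ y); rewrite eqxx.
(* Extending the coefficients by 0 outside [s] turns the relation into one over all of [T]. *)
pose c' y := if b y \in s then c (b y) else 0.
have c'0 : forall y, c' y = 0.
  apply: triangular_free; rewrite -[RHS](raddf0 phi); congr (phi _).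
  rewrite -[RHS]sc0.
  have s_perm : perm_eq s [seq b y | y <- index_enum T & b y \in s].
    apply: uniq_perm => //.
      rewrite map_inj_uniq ?filter_uniq ?index_enum_uniq //.
      exact: triangular_inj.
    move=> v; apply/idP/mapP => [vs|[y]]; last first.
      by rewrite mem_filter => /andP[? _] ->.
    have [y vE] := sb v vs; exists y => //.
    by rewrite mem_filter mem_index_enum andbT -vE.
  rewrite (perm_big _ s_perm) big_map big_filter [RHS]big_mkcond.
  apply: eq_bigr => y _.
  by rewrite /c'; case: ifP => // _; rewrite mulr0z.
move=> v vs; have [y vE] := sb v vs.
by have := c'0 y; rewrite /c' -vE vs.
Qed.

End Triangular.

(** * Representations and rank-exactness *)

Section RankExact.
Variables (k : fieldType) (d : Order.disp_t) (P : finPOrderType d).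
Implicit Types A B C M Q : rep k P.

Lemma hom_natE A B (f : rep_hom A B) s t (st : (s <= t)%O) x :
  hom_at f t (rmap A st x) = rmap B st (hom_at f s x).
Proof. by rewrite -!comp_lfunE hom_nat. Qed.

(** Kernels of structure maps always form a left exact sequence; the lifting makes it right exact.
    Their dimensions are then additive, and rank-nullity carries this over to ranks. *)
Lemma rank_exact_of_ker_lift A B C (f : rep_hom A B) (g : rep_hom B C) :
  short_exact f g ->
  (forall s t (st : (s <= t)%O),
     (lker (rmap C st) <= hom_at g s @: lker (rmap B st))%VS) ->
  rank_exact f g.
Proof.
move=> fg g_lift; split=> //; apply/ffunP=> st; rewrite !ffunE -PoszD.
move: (valP st); move: (val st).1 (val st).2 => s t {}st; congr (Posz _).
case: (fg s) (fg t) => fs0 fgs gs1 [ft0 _ _].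
have kerC : (hom_at g s @: lker (rmap B st))%VS = lker (rmap C st).
  apply/eqP; rewrite eqEsubv g_lift andbT; apply/subvP=> _ /memv_imgP[x + ->].
  by rewrite !memv_ker -hom_natE => /eqP->; rewrite linear0.
have kerA : (lker (rmap B st) :&: lker (hom_at g s)
    = hom_at f s @: lker (rmap A st))%VS.
  apply/vspaceP=> x; rewrite memv_cap -fgs; apply/andP/memv_imgP.
    case=> + /memv_imgP[a _ xE]; rewrite xE memv_ker -hom_natE => Aa.
    by exists a; rewrite // memv_ker -memv0 -ft0 memv_ker.
  case=> a; rewrite memv_ker => /eqP Aa ->; split; last exact/memv_img/memvf.
  by rewrite memv_ker -hom_natE Aa linear0.
have := limg_ker_dim (hom_at g s) (lker (rmap B st)).
rewrite kerC kerA limg_dim_eq ?fs0 ?capv0 // => dimK.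
have := limg_ker_dim (hom_at g s) fullv; rewrite gs1 capfv -fgs.
rewrite limg_dim_eq ?fs0 ?capv0 // => dimS.
have := limg_ker_dim (rmap A st) fullv; have := limg_ker_dim (rmap B st) fullv.
have := limg_ker_dim (rmap C st) fullv; rewrite !capfv => dC dB dA.
apply: (@addnI (\dim (lker (rmap B st)))); rewrite dB -dimS -dA -dC -dimK.
by rewrite addnACA.
Qed.

Definition push M (a s : P) : 'Hom(rspace M a, rspace M s) :=
  if @idP (a <= s)%O is ReflectT h then rmap M h else 0.

Lemma pushE M s t (st : (s <= t)%O) : push M s t = rmap M st.
Proof.
rewrite /push; case: {-}_ / idP => [h|/(_ st)//].
by rewrite (bool_irrelevance h st).
Qed.

Lemma push0 M s t : ~~ (s <= t)%O -> push M s t = 0.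
Proof. by rewrite /push => /negP nst; case: {-}_ / idP. Qed.

Lemma push_comp M s t u x : (s <= t)%O -> (t <= u)%O ->
  push M t u (push M s t x) = push M s u x.
Proof.
move=> st tu; rewrite !pushE ?(le_trans st) // => su.
by rewrite -comp_lfunE -rmap_comp (bool_irrelevance su (le_trans st tu)).
Qed.

Lemma push_hom A B (f : rep_hom A B) s t x :
  hom_at f t (push A s t x) = push B s t (hom_at f s x).
Proof.
case: (boolP (s <= t)%O) => st; first by rewrite !pushE hom_natE.
by rewrite !push0 // !zero_lfunE linear0.
Qed.

(** * Kernels of morphisms of representations *)

Section Kernel.
Variables (Q M : rep k P) (f : rep_hom Q M).

(** Naturality keeps the image inside the kernel, so [vsproj] merely retypes a vector that already
    lies there. *)
Definition ker_map s t (st : (s <= t)%O) :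
    'Hom(subvs_of (lker (hom_at f s)), subvs_of (lker (hom_at f t))) :=
  (linfun (vsproj (lker (hom_at f t))) \o rmap Q st \o linfun vsval)%VF.

Lemma val_ker_map s t (st : (s <= t)%O) v :
  vsval (ker_map st v) = rmap Q st (vsval v).
Proof.
rewrite !comp_lfunE !lfunE /= vsprojK // memv_ker hom_natE.
by have := subvsP v; rewrite memv_ker => /eqP->; rewrite linear0.
Qed.

Fact ker_map_id s : ker_map (lexx s) = \1%VF.
Proof.
by apply/lfunP=> v; apply: subvs_inj; rewrite val_ker_map rmap_id !id_lfunE.
Qed.

Fact ker_map_comp s t u (st : (s <= t)%O) (tu : (t <= u)%O) :
  ker_map (le_trans st tu) = (ker_map tu \o ker_map st)%VF.
Proof.
apply/lfunP=> v; apply: subvs_inj.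
by rewrite comp_lfunE !val_ker_map rmap_comp comp_lfunE.
Qed.

Definition ker_rep : rep k P :=
  @Rep k d P (fun s => subvs_of (lker (hom_at f s))) ker_map
    ker_map_id ker_map_comp.

Fact ker_incl_nat s t (st : (s <= t)%O) :
  (linfun vsval \o rmap ker_rep st = rmap Q st \o linfun vsval)%VF.
Proof.
apply/lfunP=> v; rewrite [LHS]comp_lfunE [RHS]comp_lfunE [LHS]lfunE.
by rewrite (lfunE vsval v); apply: val_ker_map.
Qed.

Definition ker_incl : rep_hom ker_rep Q :=
  @RepHom k d P ker_rep Q (fun s => linfun vsval) ker_incl_nat.

Lemma short_exact_ker : (forall s, limg (hom_at f s) = fullv) ->
  short_exact ker_incl f.
Proof.
move=> f_surj s; split=> //.
  apply/eqP/lker0P => x y; rewrite !lfunE /=; exact: subvs_inj.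
apply/vspaceP=> x; apply/memv_imgP/idP => [[v _ ->]|xf].
  by rewrite lfunE /=; apply: subvsP.
by exists (vsproj _ x); rewrite ?memvf // lfunE /= vsprojK.
Qed.

End Kernel.

(** * Binary direct sums and their classes in K0 *)

Section DirectSum.
Variables A B : rep k P.

Definition dsum_space s : vectType k := (rspace A s * rspace B s)%type.

Definition dsum_fun s t (st : (s <= t)%O) (x : dsum_space s) : dsum_space t :=
  (rmap A st x.1, rmap B st x.2).

Fact dsum_fun_linear s t (st : (s <= t)%O) : linear (dsum_fun st).
Proof. by move=> a x y; rewrite /dsum_fun !linearP. Qed.
HB.instance Definition _ s t (st : (s <= t)%O) :=
  GRing.isLinear.Build k (dsum_space s) (dsum_space t) *:%R (dsum_fun st)
    (dsum_fun_linear st).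

Fact dsum_id s : linfun (dsum_fun (lexx s)) = \1%VF.
Proof.
by apply/lfunP=> -[x y]; rewrite !lfunE /= /dsum_fun !rmap_id !lfunE.
Qed.

Fact dsum_comp s t u (st : (s <= t)%O) (tu : (t <= u)%O) :
  linfun (dsum_fun (le_trans st tu))
  = (linfun (dsum_fun tu) \o linfun (dsum_fun st))%VF.
Proof.
apply/lfunP=> -[x y]; rewrite comp_lfunE !lfunE /= /dsum_fun /=.
by rewrite !rmap_comp !comp_lfunE.
Qed.

Definition dsum : rep k P :=
  @Rep k d P dsum_space (fun s t st => linfun (dsum_fun st)) dsum_id dsum_comp.

Definition inl_fun s (x : rspace A s) : dsum_space s := (x, 0).
Fact inl_fun_linear s : linear (@inl_fun s).
Proof.
by move=> a x y; apply: injective_projections; rewrite /= ?scaler0 ?addr0.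
Qed.
HB.instance Definition _ s :=
  GRing.isLinear.Build k (rspace A s) (dsum_space s) *:%R (@inl_fun s)
    (@inl_fun_linear s).

Definition inr_fun s (x : rspace B s) : dsum_space s := (0, x).
Fact inr_fun_linear s : linear (@inr_fun s).
Proof.
by move=> a x y; apply: injective_projections; rewrite /= ?scaler0 ?addr0.
Qed.
HB.instance Definition _ s :=
  GRing.isLinear.Build k (rspace B s) (dsum_space s) *:%R (@inr_fun s)
    (@inr_fun_linear s).

Fact dsum_inl_nat s t (st : (s <= t)%O) :
  (linfun (@inl_fun t) \o rmap A st = rmap dsum st \o linfun (@inl_fun s))%VF.
Proof.
by apply/lfunP=> x; rewrite !comp_lfunE !lfunE /= /dsum_fun /inl_fun linear0.
Qed.
Definition dsum_inl : rep_hom A dsum :=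
  @RepHom k d P A dsum (fun s => linfun (@inl_fun s)) dsum_inl_nat.

Fact dsum_inr_nat s t (st : (s <= t)%O) :
  (linfun (@inr_fun t) \o rmap B st = rmap dsum st \o linfun (@inr_fun s))%VF.
Proof.
by apply/lfunP=> x; rewrite !comp_lfunE !lfunE /= /dsum_fun /inr_fun linear0.
Qed.
Definition dsum_inr : rep_hom B dsum :=
  @RepHom k d P B dsum (fun s => linfun (@inr_fun s)) dsum_inr_nat.

Section Copair.
Variables (M : rep k P) (f : rep_hom A M) (g : rep_hom B M).

Definition copair_fun s (x : dsum_space s) : rspace M s :=
  hom_at f s x.1 + hom_at g s x.2.
Fact copair_fun_linear s : linear (@copair_fun s).
Proof. by move=> a x y; rewrite /copair_fun !linearP scalerDr addrACA. Qed.
HB.instance Definition _ s :=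
  GRing.isLinear.Build k (dsum_space s) (rspace M s) *:%R (@copair_fun s)
    (@copair_fun_linear s).

Fact copair_nat s t (st : (s <= t)%O) :
  (linfun (@copair_fun t) \o rmap dsum st
   = rmap M st \o linfun (@copair_fun s))%VF.
Proof.
apply/lfunP=> x; rewrite !comp_lfunE !lfunE /= /dsum_fun /copair_fun /=.
by rewrite !hom_natE linearD.
Qed.
Definition copair : rep_hom dsum M :=
  @RepHom k d P dsum M (fun s => linfun (@copair_fun s)) copair_nat.

Lemma copair_inl s x : hom_at copair s (hom_at dsum_inl s x) = hom_at f s x.
Proof. by rewrite !lfunE /= /copair_fun /= linear0 addr0. Qed.

Lemma copair_inr s x : hom_at copair s (hom_at dsum_inr s x) = hom_at g s x.
Proof. by rewrite !lfunE /= /copair_fun /= linear0 add0r. Qed.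

End Copair.

Fact dsum_snd_nat s t (st : (s <= t)%O) :
  (linfun (snd : dsum_space t -> rspace B t) \o rmap dsum st
   = rmap B st \o linfun (snd : dsum_space s -> rspace B s))%VF.
Proof. by apply/lfunP=> x; rewrite !comp_lfunE !lfunE /=. Qed.
Definition dsum_snd : rep_hom dsum B :=
  @RepHom k d P dsum B (fun s => linfun (snd : dsum_space s -> rspace B s))
    dsum_snd_nat.

(** The split sequence is rank-exact: [dsum_inr] is a natural section of [dsum_snd], so it lifts
    kernels. *)
Lemma K0_class_dsum : K0_class dsum = K0_class A + K0_class B.
Proof.
have inrK s x : hom_at dsum_snd s (hom_at dsum_inr s x) = x by rewrite !lfunE.
apply: (@K0_class_rank_exact _ _ _ _ _ _ dsum_inl dsum_snd).
apply: rank_exact_of_ker_lift => [s|s t st].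
  split.
  - by apply/eqP/lker0P => x y; rewrite !lfunE /= => -[].
  - apply/vspaceP=> x; rewrite memv_ker lfunE /=; apply/memv_imgP/eqP.
      by case=> y _ ->; rewrite lfunE.
    move=> x0; exists x.1; rewrite ?memvf // lfunE /= /inl_fun -x0.
    exact: surjective_pairing.
  - apply/vspaceP=> x; rewrite memvf; apply/memv_imgP.
    by exists (hom_at dsum_inr s x); rewrite ?memvf.
apply/subvP=> y; rewrite memv_ker => /eqP By0; apply/memv_imgP.
exists (hom_at dsum_inr s y) => //.
by rewrite memv_ker -hom_natE By0 linear0.
Qed.

End DirectSum.

(** For a zero object the identities form a rank-exact sequence from [M] to [M] to [M], whence [M] =
    [M] + [M]. *)
Lemma K0_class_zero M : (forall s, \dim {: rspace M s} = 0%N) -> K0_class M = 0.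
Proof.
move=> M0.
have id_nat s t (st : (s <= t)%O) : (\1 \o rmap M st = rmap M st \o \1)%VF.
  by rewrite comp_lfun1l comp_lfun1r.
have vs0 s (U : {vspace rspace M s}) : U = 0%VS.
  by apply/eqP; rewrite -dimv_eq0 -leqn0 -(M0 s) dimvS ?subvf.
have MM : rank_exact (RepHom id_nat) (RepHom id_nat).
  apply: rank_exact_of_ker_lift => [s|s t st]; last first.
    by rewrite [lker _]vs0 sub0v.
  by rewrite [lker _]vs0 [limg _]vs0 [fullv]vs0.
have := K0_class_rank_exact MM.
by rewrite -[X in X = _]addr0 => /addrI <-.
Qed.

Lemma dim_interval_map (I : {set P}) (s t : P) (st : (s <= t)%O) :
  \dim (limg (@interval_map k d P I s t st)) = (s \in I) && (t \in I).
Proof.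
have le1 (b : bool) (U : {vspace 'rV[k]_b}) : (\dim U <= b)%N.
  by rewrite (leq_trans (dimvS (subvf U))) // dimvf /dim /= mul1n.
rewrite /interval_map; case: (s \in I); case: (t \in I); last 3 first.
- by apply/eqP; rewrite -leqn0 le1.
- set h := linfun _; apply/eqP; rewrite -leqn0.
  by rewrite (leq_trans _ (le1 false fullv)) // -(limg_ker_dim h) leq_addl.
- by apply/eqP; rewrite -leqn0 le1.
rewrite [linfun _](_ : _ = \1%VF) ?lim1g ?dimvf //.
apply/lfunP=> v; rewrite !lfunE /= [const_mx 1](_ : _ = 1%:M) ?mulmx1 //.
by apply/matrixP=> i j; rewrite !ord1 !mxE.
Qed.

End RankExact.

(** * Rank functionals attached to hooks *)

Section RankFunctionals.
Variables (d : Order.disp_t) (P : finPOrderType d).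

Definition lhook := {x : P * option P | lt_oo x.1 x.2}.
Definition uhook := {x : option P * P | oo_lt x.1 x.2}.
HB.instance Definition _ := Finite.on lhook.
HB.instance Definition _ := Finite.on uhook.

(** The default 0 off the order agrees with the zero map chosen by [push]. *)
Definition rank_at (g : {ffun ordered_pair P -> int}) (s t : P) : int :=
  oapp g 0 (insub (s, t)).

Lemma rank_atE (g : {ffun ordered_pair P -> int}) (st : ordered_pair P) :
  rank_at g (val st).1 (val st).2 = g st.
Proof. by rewrite /rank_at -surjective_pairing valK. Qed.

Lemma rank_atB f g s t : rank_at (f - g) s t = rank_at f s t - rank_at g s t.
Proof.
by rewrite /rank_at; case: insub => [st|] /=; rewrite ?subr0 ?ffunE.
Qed.

(** On [Rk M] this is the dimension of the kernel of M a -> M b, that is, of Hom(<a,b<, M);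
    [b = None] contributes rank 0. *)
Definition lower_ker (g : {ffun ordered_pair P -> int}) : {ffun lhook -> int} :=
  [ffun x : lhook => let: (a, b) := val x in
     rank_at g a a - oapp (rank_at g a) 0 b].

Fact lower_ker_additive : zmod_morphism lower_ker.
Proof.
move=> f g; apply/ffunP=> x; rewrite !ffunE; case: (val x) => a [b|] /=.
  by rewrite !rank_atB !opprD addrACA.
by rewrite rank_atB !subr0.
Qed.
HB.instance Definition _ :=
  GRing.isZmodMorphism.Build _ _ lower_ker lower_ker_additive.

Definition upper_ker (g : {ffun ordered_pair P -> int}) : {ffun uhook -> int} :=
  [ffun x : uhook => let: (a, b) := val x in
     rank_at g b b - oapp ((rank_at g)^~ b) 0 a].

Fact upper_ker_additive : zmod_morphism upper_ker.
Proof.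
move=> f g; apply/ffunP=> x; rewrite !ffunE; case: (val x) => [[a|] b] /=.
  by rewrite !rank_atB !opprD addrACA.
by rewrite rank_atB !subr0.
Qed.
HB.instance Definition _ :=
  GRing.isZmodMorphism.Build _ _ upper_ker upper_ker_additive.

(** The hooks starting at -oo recover the diagonal of [g]; the other hooks then recover the
    remaining entries. *)
Lemma upper_ker_eq0 g : upper_ker g = 0 -> g = 0.
Proof.
move=> g0.
have g_diag b : rank_at g b b = 0.
  have := congr1 (fun h : {ffun uhook -> int} =>
    h (exist _ (None, b) isT : uhook)) g0.
  by rewrite !ffunE /= subr0.
apply/ffunP=> st; rewrite -rank_atE ffunE.
case: st => -[s t] /= st; case: (eqVneq s t) => [->|s_t]; first exact: g_diag.
have lt_st : oo_lt (Some s) t by rewrite /= lt_neqAle s_t.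
have := congr1 (fun h : {ffun uhook -> int} =>
  h (exist _ (Some s, t) lt_st : uhook)) g0.
by rewrite !ffunE /= g_diag sub0r => /eqP; rewrite oppr_eq0 => /eqP.
Qed.

(** [down] and [up] are numerical gradings, strictly increasing and strictly decreasing along the
    order; heights of hooks and segments are built from them. *)
Definition down (s : P) := #|[set t | (t <= s)%O]|.
Definition up (s : P) := #|[set t | (s <= t)%O]|.

Lemma down_le s t : (s <= t)%O -> (down s <= down t)%N.
Proof.
move=> st; apply/subset_leq_card/subsetP=> u; rewrite !inE => us.
exact: le_trans st.
Qed.

Lemma up_le s t : (s <= t)%O -> (up t <= up s)%N.
Proof.
move=> st; apply/subset_leq_card/subsetP=> u; rewrite !inE; exact: le_trans.
Qed.

Lemma down_inj s t : (s <= t)%O -> down s = down t -> s = t.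
Proof.
move=> st e; suff ts : (t <= s)%O by apply/eqP; rewrite eq_le st.
suff /setP/(_ t) : [set u | (u <= s)%O] = [set u | (u <= t)%O].
  by rewrite !inE lexx.
apply/eqP; rewrite eqEcard -/(down s) -/(down t) e leqnn andbT.
by apply/subsetP=> u; rewrite !inE => us; apply: le_trans st.
Qed.

Lemma up_inj s t : (s <= t)%O -> up s = up t -> s = t.
Proof.
move=> st e; suff ts : (t <= s)%O by apply/eqP; rewrite eq_le st.
suff /setP/(_ s) : [set u | (t <= u)%O] = [set u | (s <= u)%O].
  by rewrite !inE lexx.
apply/eqP; rewrite eqEcard -/(up s) -/(up t) e leqnn andbT.
by apply/subsetP=> u; rewrite !inE; apply: le_trans.
Qed.

Lemma down_lt s : (down s < #|P|.+1)%N.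
Proof. by rewrite ltnS max_card. Qed.

Lemma up_lt s : (up s < #|P|.+1)%N.
Proof. by rewrite ltnS max_card. Qed.

End RankFunctionals.

(** * Covers by lower hooks *)

Section Hooks.
Variables (k : fieldType) (d : Order.disp_t) (P : finPOrderType d).
Implicit Types A B C M Q : rep k P.

Lemma rank_at_Rk M s t : rank_at (Rk M) s t = (\dim (limg (push M s t)))%:Z.
Proof.
rewrite /rank_at; case: insubP => [st _ stE|nst] /=; last first.
  by rewrite push0 // lim0g dimv0.
rewrite ffunE; move: (valP st); rewrite stE /= => le_st.
by rewrite pushE.
Qed.

Lemma rank_at_interval (I : {set P}) (cI : convex I) s t :
  rank_at (Rk (@interval_rep k d P I cI)) s t
  = [&& (s <= t)%O, s \in I & t \in I].
Proof.
rewrite rank_at_Rk; case: (boolP (s <= t)%O) => st.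
  by rewrite pushE dim_interval_map.
by rewrite push0 // lim0g dimv0.
Qed.

Definition lhook_rep (x : lhook P) : rep k P :=
  lower_hook_rep k (val x).1 (val x).2.
Definition uhook_rep (x : uhook P) : rep k P :=
  upper_hook_rep k (val x).1 (val x).2.

(* Hom(<a,b<, M) for x = (a, b). *)
Definition hook_ker M (x : P * option P) : {vspace rspace M x.1} :=
  if x.2 is Some b then lker (push M x.1 b) else fullv.

Lemma dim_hook_ker M (x : lhook P) :
  (\dim (hook_ker M (val x)))%:Z = lower_ker (Rk M) x.
Proof.
rewrite ffunE /hook_ker; case: x => -[a b] /= ab.
have push_id : limg (push M a a) = fullv by rewrite pushE rmap_id lim1g.
rewrite rank_at_Rk push_id; case: b ab => [b|] _ /=; last by rewrite subr0.
rewrite rank_at_Rk -(limg_ker_dim (push M a b) fullv) capfv.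
by rewrite PoszD addrK.
Qed.

Lemma hook_ker_hom A B (f : rep_hom A B) x w :
  w \in hook_ker A x -> hom_at f x.1 w \in hook_ker B x.
Proof.
rewrite /hook_ker; case: x.2 => [b|]; rewrite ?memvf // !memv_ker -push_hom.
by move=> /eqP->; rewrite linear0.
Qed.

Lemma hook_ker_lhook (x : lhook P) w : w \in hook_ker (lhook_rep x) (val x).
Proof.
rewrite /hook_ker; case E: (val x).2 => [b|]; last exact: memvf.
(* The endpoint [b] is outside the hook, so the target is a space of rows without entries. *)
rewrite memv_ker; apply/eqP/rowP => j; exfalso; case: j => j.
by rewrite inE E lexx andbF.
Qed.

(** * The morphism from a lower hook determined by a kernel vector *)

Section HookMap.
Variables (M : rep k P) (x : lhook P) (v : rspace M (val x).1).
Hypothesis vx : v \in hook_ker M (val x).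

(** A Yoneda map sending the generator to [v]. Rows have length 0 or 1, and summing the entries
    reads off the scalar in both cases. *)
Definition hook_fun s (r : rspace (lhook_rep x) s) : rspace M s :=
  (\sum_j r 0 j) *: push M (val x).1 s v.

Fact hook_fun_linear s : linear (@hook_fun s).
Proof.
move=> a r q; rewrite /hook_fun scalerA mulr_sumr -scalerDl -big_split /=.
by congr (_ *: _); apply: eq_bigr => j _; rewrite !mxE.
Qed.
HB.instance Definition _ s :=
  GRing.isLinear.Build k (rspace (lhook_rep x) s) (rspace M s) *:%R
    (@hook_fun s) (@hook_fun_linear s).

Fact hook_nat s t (st : (s <= t)%O) :
  (linfun (@hook_fun t) \o rmap (lhook_rep x) st
   = rmap M st \o linfun (@hook_fun s))%VF.
Proof.
set a := (val x).1; set ob := (val x).2; have ab : lt_oo a ob := valP x.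
apply/lfunP=> r; rewrite [LHS]comp_lfunE [RHS]comp_lfunE !(lfunE (@hook_fun _)).
(* The scalar is carried along unchanged inside the hook and becomes 0 on leaving it. *)
have rE : \sum_j rmap (lhook_rep x) st r 0 j
    = (\sum_j r 0 j) *+ (t \in lower_hook a ob).
  transitivity (\sum_(j < (t \in lower_hook a ob)) \sum_i r 0 i);
    last by rewrite sumr_const card_ord.
  apply: eq_bigr => j _.
  by rewrite lfunE /= mxE; apply: eq_bigr => i _; rewrite mxE mulr1.
rewrite [LHS](congr1 (fun c => c *: _) rE) [RHS]linearZ /= -/a.
have /orP[sI|sI] := orbN (s \in lower_hook a ob); last first.
  suff -> : \sum_j r 0 j = 0 by rewrite mul0rn !scale0r.
  by apply: big1 => -[j jI]; exfalso; rewrite (negPf sI) in jI.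
move: (\sum_j r 0 j) {rE} => c.
move: sI; rewrite inE => /andP[le_as _].
rewrite -(pushE M st) push_comp // inE (le_trans le_as st) /=.
move: ab vx; rewrite /ob /hook_ker -/a; case: (val x).2 => [b|] //=.
(* Beyond the hook, the map from [a] to [t] factors through [b], where [v] dies. *)
case: (boolP (b <= t)%O) => //= bt ab; rewrite memv_ker => /eqP av.
by rewrite -(push_comp _ (ltW ab) bt) av linear0 !scaler0.
Qed.

Definition hook_hom : rep_hom (lhook_rep x) M :=
  @RepHom k d P (lhook_rep x) M (fun s => linfun (@hook_fun s)) hook_nat.

Lemma hook_hom_gen :
  exists2 w, w \in hook_ker (lhook_rep x) (val x) & hom_at hook_hom _ w = v.
Proof.
have aI : (val x).1 \in lower_hook (val x).1 (val x).2.
  have := valP x; rewrite inE lexx; case: (val x).2 => [b|] //= ab.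
  by apply/negP => /(lt_le_trans ab); rewrite ltxx.
exists (const_mx 1 : 'rV_(_ \in _)); last first.
  rewrite lfunE /= /hook_fun; under eq_bigr do rewrite mxE.
  by rewrite sumr_const card_ord aI scale1r pushE rmap_id id_lfunE.
exact: hook_ker_lhook.
Qed.

End HookMap.

(** One hook is added for each listed kernel vector, which is hit by the generator of that hook;
    lifts from earlier summands persist through the inclusions. *)
Lemma hook_family_cover M
    (l : seq {x : lhook P & subvs_of (hook_ker M (val x))}) :
  exists Q (f : rep_hom Q M),
    K0_class Q = \sum_(p <- l) K0_class (lhook_rep (tag p)) /\
    (forall p, p \in l ->
      vsval (tagged p) \in (hom_at f _ @: hook_ker Q (val (tag p)))%VS).
Proof.
elim: l => [|[x v] l [Q [f [QE fl]]]].
  (* The empty sum is realized by the interval representation of the empty set. *)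
  have c0 : convex (set0 : {set P}) by move=> s t u; rewrite inE.
  have nat0 s t (st : (s <= t)%O) :
      (0 \o rmap (interval_rep k c0) st = rmap M st \o 0)%VF.
    by rewrite comp_lfun0l comp_lfun0r.
  exists (interval_rep k c0), (RepHom nat0); split=> //.
  rewrite big_nil; apply: K0_class_zero => s.
  by rewrite dimvf /dim /= inE mul1n.
have vx := subvsP v.
exists (dsum (lhook_rep x) Q), (copair (hook_hom vx) f); split.
  by rewrite K0_class_dsum QE big_cons.
move=> p; rewrite inE => /predU1P[->|/fl /memv_imgP[w wQ ->]] /=.
  have [w wL wv] := hook_hom_gen vx; apply/memv_imgP.
  exists (hom_at (dsum_inl _ _) _ w).
    exact: (hook_ker_hom (dsum_inl _ _) wL).
  by rewrite copair_inl.
apply/memv_imgP; exists (hom_at (dsum_inr _ _) _ w).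
  exact: (hook_ker_hom (dsum_inr _ _) wQ).
by rewrite copair_inr.
Qed.

Lemma hook_cover M : exists Q (f : rep_hom Q M),
  K0_class Q = \sum_x K0_class (lhook_rep x) *~ lower_ker (Rk M) x /\
  (forall x : lhook P,
     (hook_ker M (val x) <= hom_at f _ @: hook_ker Q (val x))%VS).
Proof.
pose basis (x : lhook P) : seq (subvs_of (hook_ker M (val x))) := vbasis fullv.
(* Listing a basis of every kernel gives each hook the multiplicity dim Hom(L, M). *)
pose l := [seq Tagged (fun x : lhook P => subvs_of (hook_ker M (val x))) u
            | x <- index_enum (lhook P), u <- basis x].
have [Q [f [QE fl]]] := hook_family_cover l.
exists Q, f; split=> [|x].
  rewrite QE big_allpairs_dep /=; apply: eq_bigr => x _.
  rewrite big_const_seq count_predT size_tuple iter_addr_0.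
  by rewrite -dim_hook_ker -pmulrn dimvf.
apply/subvP=> v vx; rewrite -(vsprojK vx) (coord_vbasis (memvf (vsproj _ v))).
rewrite linear_sum; apply: memv_suml => i _; rewrite linearZ memvZ //.
apply: (fl (Tagged _ _)); apply: allpairs_f_dep; first exact: mem_index_enum.
by rewrite mem_nth ?size_tuple.
Qed.

(** [N] is the kernel of the hook cover: lifting for the hooks ending at +oo is surjectivity, and
    lifting for the others is rank-exactness. *)
Lemma hook_cover_syzygy M : exists N,
  K0_class N
  = \sum_x K0_class (lhook_rep x) *~ lower_ker (Rk M) x - K0_class M.
Proof.
have [Q [f [QE f_lift]]] := hook_cover M.
exists (ker_rep f).
have f_surj s : limg (hom_at f s) = fullv.
  by apply/eqP; rewrite eqEsubv subvf; apply: (f_lift (exist _ (s, None) isT)).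
have : rank_exact (ker_incl f) f.
  apply: rank_exact_of_ker_lift => [|s t st]; first exact: short_exact_ker.
  (* Hooks have strict endpoints, so [s = t] is separate; there the structure map is the identity,
     with zero kernel. *)
  case: (eqVneq s t) => [s_t|s_t].
    subst t; rewrite (bool_irrelevance st (lexx s)) rmap_id.
    by apply/subvP=> y; rewrite memv_ker id_lfunE => /eqP->; rewrite mem0v.
  have lt_st : lt_oo s (Some t) by rewrite /= lt_neqAle s_t.
  by have := f_lift (exist _ (s, Some t) lt_st); rewrite /hook_ker /= !pushE.
by move/K0_class_rank_exact; rewrite -QE => ->; rewrite addrK.
Qed.

Lemma K0_class_eq0 M : lower_ker (Rk M) = 0 -> K0_class M = 0.
Proof.
move=> M0; apply: K0_class_zero => s; apply/eqP; rewrite -eqz_nat.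
by have := dim_hook_ker M (exist _ (s, None) isT); rewrite M0 ffunE => /eqP.
Qed.

End Hooks.

(** * The three bases *)

Section Bases.
Variables (k : fieldType) (d : Order.disp_t) (P : finPOrderType d).

Definition segment_at (x : ordered_pair P) : rep k P :=
  segment_rep k (val x).1 (val x).2.

(** The value [#|P|.+1] exceeds every [down], placing +oo strictly above all of [P]. *)
Definition lhook_height (x : lhook P) : nat :=
  down (val x).1 + oapp (@down _ P) #|P|.+1 (val x).2.

(** Since [up] reverses the order, -oo receives the value above every [up]. *)
Definition uhook_height (x : uhook P) : nat :=
  oapp (@up _ P) #|P|.+1 (val x).1 + up (val x).2.

Definition pair_height (x : ordered_pair P) : nat :=
  down (val x).1 + up (val x).2.

Lemma ltn_add_neq m n p q : (m <= p)%N -> (n <= q)%N -> (m, n) <> (p, q) ->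
  (m + n < p + q)%N.
Proof.
move=> mp nq; rewrite ltn_neqAle leq_add // andbT => mn.
apply/eqP => e; apply: mn.
have := leqif_add (leqif_eq mp) (leqif_eq nq); rewrite e => -[_].
by rewrite eqxx => /esym/andP[/eqP-> /eqP->].
Qed.

Lemma segment_unitriangular :
  unitriangular (fun x => Rk (segment_at x)) idfun pair_height.
Proof.
(* The rank matrix of the segments is the zeta matrix of inclusion of segments. *)
have E (x y : ordered_pair P) : Rk (segment_at y) x =
    [&& ((val y).1 <= (val x).1)%O & ((val x).2 <= (val y).2)%O].
  case: x y => -[s t] /= st [[a b] /= ab].
  rewrite -rank_atE rank_at_interval st !inE /=.
  case: (boolP (a <= s)%O) => as_ //=; case: (boolP (t <= b)%O) => tb;
    rewrite ?andbF ?andbT //=.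
  by rewrite (le_trans st tb) (le_trans as_ st).
split=> [y|x y]; first by rewrite /= E !lexx.
rewrite /= E; case: andP => // -[le1 le2] _ yx; apply: ltn_add_neq.
- exact: down_le.
- exact: up_le.
case=> /(down_inj le1) e1 /esym/(up_inj le2) e2; case/eqP: yx; apply/val_inj.
by rewrite [val y]surjective_pairing e1 -e2 -surjective_pairing.
Qed.

Lemma lhook_unitriangular :
  unitriangular (fun x => K0_class (lhook_rep k x)) (@lower_ker d P \o RkK0)
    lhook_height.
Proof.
(* The entry is 1 exactly when the hook of [y] contains the first endpoint of [x] but not the
   second, +oo lying in no hook. *)
have E (x y : lhook P) : lower_ker (Rk (lhook_rep k y)) x =
    [&& ((val y).1 <= (val x).1)%O,
        oapp (fun b => ~~ (b <= (val x).1)%O) true (val y).2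
      & if (val x).2 is Some b
        then oapp (fun b' => (b' <= b)%O) false (val y).2 else true].
  rewrite ffunE; case: x y => -[a b] /= ab [[c e] /= ce].
  rewrite /lhook_rep /lower_hook_rep rank_at_interval !inE lexx /=.
  have -> : (if e is Some j' then ~~ (j' <= a)%O else true)
     = oapp (fun b => ~~ (b <= a)%O) true e by case: e ce.
  case: b ab => [b|] /= ab; last by rewrite subr0 andbT andbb.
  rewrite rank_at_interval !inE (ltW ab) /=.
  case: (boolP (c <= a)%O) => //= ca; rewrite (le_trans ca (ltW ab)) /=.
  case: e ce => //= e ce; case: (boolP (e <= a)%O) => //= ea.
  by case: (boolP (e <= b)%O).
split=> [y|x y] /=; rewrite RkK0E E.
  case: y => -[a [b|]] /= ab; rewrite !lexx //= andbT.
  rewrite (_ : (b <= a)%O = false) //.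
  by apply/negP=> /(lt_le_trans ab); rewrite ltxx.
case: x y => -[a b] ab [[c e] ce] /=; case: and3P => // -[le1 _ le2] _ yx.
apply: ltn_add_neq => /=.
- exact: down_le.
- case: b e le2 {ab ce yx} => [b|] [e|] //=; first exact: down_le.
  by rewrite ltnW ?down_lt.
case=> /(down_inj le1) e1 e2; case/eqP: yx; apply/val_inj => /=.
congr (_, _) => //.
case: b e le2 e2 {ab ce} => [b|] [e|] //= => [eb /(down_inj eb) ->//|_ e2].
by have := down_lt e; rewrite e2 ltnn.
Qed.

Lemma uhook_unitriangular :
  unitriangular (fun x => K0_class (uhook_rep k x)) (@upper_ker d P \o RkK0)
    uhook_height.
Proof.
(* Dually, the entry is 1 when the hook of [y] contains the second endpoint of [x] but not the
   first. *)
have E (x y : uhook P) : upper_ker (Rk (uhook_rep k y)) x =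
    [&& ((val x).2 <= (val y).2)%O,
        oapp (fun a => ~~ ((val x).2 <= a)%O) true (val y).1
      & if (val x).1 is Some a
        then oapp (fun a' => (a <= a')%O) false (val y).1 else true].
  rewrite ffunE; case: x y => -[a b] /= ab [[c e] /= ce].
  rewrite /uhook_rep /upper_hook_rep rank_at_interval !inE lexx /=.
  have -> : (if c is Some j' then ~~ (b <= j')%O else true)
     = oapp (fun a => ~~ (b <= a)%O) true c by case: c ce.
  case: a ab => [a|] /= ab; last by rewrite subr0 andbT andbb andbC.
  rewrite rank_at_interval !inE (ltW ab) /=.
  case: (boolP (b <= e)%O) => //= be; rewrite ?andbF //.
  rewrite (le_trans (ltW ab) be) /=.
  case: c ce => //= c ce; case: (boolP (b <= c)%O) => //= bc; rewrite ?andbF //.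
  by case: (boolP (a <= c)%O).
split=> [y|x y] /=; rewrite RkK0E E.
  case: y => -[[a|] b] /= ab; rewrite !lexx //= andbT.
  rewrite (_ : (b <= a)%O = false) //.
  by apply/negP=> /(lt_le_trans ab); rewrite ltxx.
case: x y => -[a b] ab [[c e] ce] /=; case: and3P => // -[le1 _ le2] _ yx.
apply: ltn_add_neq => /=.
- case: a c le2 {ab ce yx} => [a|] [c|] //=; first exact: up_le.
  by rewrite ltnW ?up_lt.
- exact: up_le.
case=> e2 /esym/(up_inj le1) e1; case/eqP: yx; apply/val_inj => /=.
congr (_, _) => //.
case: a c le2 e2 {ab ce} => [a|] [c|] //= => [ac /esym/(up_inj ac) ->//|_ e2].
by have := up_lt c; rewrite e2 ltnn.
Qed.

(** Elimination stays among classes of objects by taking syzygies, and stops at an object with all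
    hook kernels zero, hence a zero object. *)
Lemma K0_class_lhook_span (M : rep k P) :
  Zspan (fun x => K0_class (lhook_rep k x)) (K0_class M).
Proof.
apply: (triangular_span lhook_unitriangular
  (S := fun x => exists M : rep k P, x = K0_class M)); last by exists M.
  move=> _ [{}M ->]; rewrite /= RkK0E.
  by have [N <-] := hook_cover_syzygy M; exists N.
by move=> _ [{}M ->]; rewrite /= RkK0E; apply: K0_class_eq0.
Qed.

(** A representative is a formal integer combination of isomorphism classes, and closure under
    subtraction yields sums and integer multiples. *)
Lemma K0_ind (S : K0 k P -> Prop) : S 0 -> (forall M, S (K0_class M)) ->
  (forall x y, S x -> S y -> S (x - y)) -> forall x, S x.
Proof.
move=> S0 SM SB x.
have SD y z : S y -> S z -> S (y + z).
  move=> Sy Sz; rewrite -[z]opprK; apply: (SB _ _) => //.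
  by rewrite -[- z]add0r; apply: (SB _ _).
have SMn y n : S y -> S (y *+ n).
  by move=> Sy; elim: n => [|n IHn]; rewrite ?mulr0n // mulrS; apply: SD.
rewrite -[x](@reprK _ (K0 k P)) -[repr x]freeg_sumE raddf_sum /=.
elim: (dom (repr x)) => [|c l IHl]; first by rewrite big_nil.
rewrite big_cons; apply: SD => //; have [M <-] := isoclass_surj c.
rewrite -[coeff _ _]intz -freegU_mulz raddfMz -/(K0_class M).
case: (coeff _ _) => n; first exact/SMn/SM.
by rewrite NegzE mulrNz -[- _]add0r; apply: (SB _ _) => //; apply/SMn/SM.
Qed.

Lemma lhook_span (x : K0 k P) :
  Zspan (fun y : lhook P => K0_class (lhook_rep k y)) x.
Proof.
elim/K0_ind: x => [|M|x y [c ->] [e ->]]; last 1 first.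
- exists (fun z => c z - e z); under [RHS]eq_bigr do rewrite mulrzBr.
  by rewrite sumrB.
- by exists (fun=> 0); rewrite big1 // => x _; rewrite mulr0z.
- exact: K0_class_lhook_span.
Qed.

(** Every element is a combination of lower hooks, whose coefficients are already determined by
    [lower_ker] of its rank. *)
Lemma RkK0_inj : injective (@RkK0 k d P).
Proof.
apply: raddf_inj => x; have [c ->] := lhook_span x => Rk0.
have c0 : forall y, c y = 0.
  by apply: (triangular_free lhook_unitriangular); rewrite /= Rk0 raddf0.
by rewrite big1 // => y _; rewrite c0 mulr0z.
Qed.

Lemma segment_unitriangular_K0 :
  unitriangular (fun x => K0_class (segment_at x)) (@RkK0 k d P) pair_height.
Proof.
by case: segment_unitriangular => s1 sT; split=> [y|x y] /=;
  rewrite RkK0E; [apply: s1 | apply: sT].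
Qed.

Lemma RkK0_bij : bijective (@RkK0 k d P).
Proof.
have RkK0_surj g : exists x, @RkK0 k d P x = g.
  (* Elimination in the target itself, with the identity as [phi]. *)
  have [c ->] : Zspan (fun x => Rk (segment_at x)) g.
    exact: (triangular_span segment_unitriangular (S := fun=> True)).
  exists (\sum_x K0_class (segment_at x) *~ c x).
  by rewrite raddf_sum; apply: eq_bigr => x _; rewrite raddfMz /= RkK0E.
have [h hK] := choice RkK0_surj.
by exists h => // x; apply: RkK0_inj.
Qed.

Lemma RkK0_eq0 (x : K0 k P) : RkK0 x = 0 -> x = 0.
Proof. by move=> x0; apply: RkK0_inj; rewrite x0 raddf0. Qed.

Lemma segment_span (x : K0 k P) :
  Zspan (fun y => K0_class (segment_at y)) x.
Proof.
apply: (triangular_span segment_unitriangular_K0 (S := fun=> True)) => // {}x _.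
exact: RkK0_eq0.
Qed.

(** [upper_ker] and [RkK0] both have trivial kernel, so elimination runs on all of K0 at once. *)
Lemma uhook_span (x : K0 k P) :
  Zspan (fun y : uhook P => K0_class (uhook_rep k y)) x.
Proof.
apply: (triangular_span uhook_unitriangular (S := fun=> True)) => // {}x _.
by move/upper_ker_eq0; apply: RkK0_eq0.
Qed.

End Bases.

Local Open Scope classical_set_scope.

Theorem mainTheorem4 (k : fieldType) (d : Order.disp_t) (P : finPOrderType d) :
  bijective (RkK0 : {additive K0 k P -> {ffun ordered_pair P -> int}}) /\
  Zbasis [set x : K0 k P | exists i j : P,
            (i <= j)%O /\ x = K0_class (segment_rep k i j)] /\
  Zbasis [set x : K0 k P | exists (i : P) (j : option P),
            lt_oo i j /\ x = K0_class (lower_hook_rep k i j)] /\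
  Zbasis [set x : K0 k P | exists (i : option P) (j : P),
            oo_lt i j /\ x = K0_class (upper_hook_rep k i j)].
Proof.
(* Bundling both indices with their order condition turns each set into the range of a family over a
   finite type, as [triangular_Zbasis] expects. *)
have range_sig (S T : Type) (p : S * T -> bool) (F : S -> T -> K0 k P) :
    [set x | exists i j, p (i, j) /\ x = F i j]
    = [set x | exists y : {ij | p ij}, x = F (val y).1 (val y).2].
  apply/seteqP; split=> x /=.
    by case=> i [j [pij ->]]; exists (exist _ (i, j) pij).
  by case=> -[[i j] pij] ->; exists i, j.
split; first exact: RkK0_bij.
split; [|split].
- rewrite (range_sig P P (fun ij => ij.1 <= ij.2)%O
    (fun i j => K0_class (segment_rep k i j))).
  exact: (triangular_Zbasis (segment_unitriangular_K0 k P)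
    (@segment_span k d P)).
- rewrite (range_sig P (option P) (fun ij => lt_oo ij.1 ij.2)
    (fun i j => K0_class (lower_hook_rep k i j))).
  exact: (triangular_Zbasis (lhook_unitriangular k P) (@lhook_span k d P)).
- rewrite (range_sig (option P) P (fun ij => oo_lt ij.1 ij.2)
    (fun i j => K0_class (upper_hook_rep k i j))).
  exact: (triangular_Zbasis (uhook_unitriangular k P) (@uhook_span k d P)).
Qed.
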